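(* Let $\{V_n\}_{n\ge 0}$ be the Fennessey-Larcombe-French sequence, defined by $V_0=1$, $V_1=8$ and, for $n\ge 2$, $$(n-1)n^2 V_n = 8(n-1)(3n^2-n-1)V_{n-1} - 128(n-2)n^2 V_{n-2}.$$ Then the sequence $\{V_n^2 - V_{n-1}V_{n+1}\}_{n\ge 2}$ is strictly log-convex, that is, for all integers $n\ge 3$, $$(V_n^2 - V_{n-1}V_{n+1})^2 < (V_{n-1}^2 - V_{n-2}V_n)(V_{n+1}^2 - V_nV_{n+2}).$$
   Context: A real sequence $\{S_n\}$ is strictly log-convex if $S_n^2 < S_{n-1}S_{n+1}$ for all admissible $n$. *)

(* Defs.v *)
From Stdlib Require Import Reals Lra Lia.
Open Scope R_scope.

(* The sequence {S_n}_{n >= m} is strictly log-convex; the admissible indices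
   are those n for which n - 1, n and n + 1 are all >= m. *)
Definition strictly_log_convex_from (m : nat) (S : nat -> R) : Prop :=
  forall n : nat, (m + 1 <= n)%nat -> S n ^ 2 < S (n - 1)%nat * S (n + 1)%nat.

(* For n >= 2 the coefficient (n-1) n^2 is nonzero, so these conditions
   determine V uniquely. *)
Definition Fennessey_Larcombe_French (V : nat -> R) : Prop :=
  V 0%nat = 1 /\ V 1%nat = 8 /\
  forall n : nat, (2 <= n)%nat ->
    (INR n - 1) * INR n ^ 2 * V n =
      8 * (INR n - 1) * (3 * INR n ^ 2 - INR n - 1) * V (n - 1)%nat
      - 128 * (INR n - 2) * INR n ^ 2 * V (n - 2)%nat.

Lemma Fennessey_Larcombe_French_exists :
  exists V : nat -> R, Fennessey_Larcombe_French V.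
Proof.
pose (step := fun (n : nat) (p : R * R) =>
  (snd p, (8 * (INR n - 1) * (3 * INR n ^ 2 - INR n - 1) * snd p
           - 128 * (INR n - 2) * INR n ^ 2 * fst p)
          / ((INR n - 1) * INR n ^ 2))).
pose (W := nat_rect (fun _ => (R * R)%type) (1, 8) (fun k => step (k + 2)%nat)).
exists (fun n => fst (W n)).
split; [reflexivity | split; [reflexivity |]].
intros n Hn.
destruct n as [|[|n]]; [lia | lia |].
replace (S (S n) - 1)%nat with (S n) by lia.
replace (S (S n) - 2)%nat with n by lia.
change (fst (W (S (S n)))) with (snd (step (n + 2)%nat (W n))).
change (fst (W (S n))) with (snd (W n)).
replace (n + 2)%nat with (S (S n)) by lia.
unfold step; cbn [snd].
pose proof (pos_INR n).
rewrite !S_INR; field; lra.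
Qed.

(* Main.v *)
(** The characteristic roots of the recurrence at infinity are 8 and 16, and the
    ratio [V n / V (n - 1)] has the asymptotic expansion
    [16 + 16/n^3 + 48/n^4 + 192/n^5 + 1008/n^6 + O(1/n^7)].  Replacing the
    coefficient 1008 by 256 gives a lower bound valid for all [n >= 7], by induction
    from the recurrence.  The recurrence turns the required inequality at [n] into the
    positivity of a quartic form in [V (n - 1)] and [V n]; expressed in [V (n - 1)]
    and the excess of [V n] over the lower bound, all coefficients of this form are
    polynomials in [n - 2] with nonnegative coefficients, so no upper bound
    on the ratio is needed.  The cases [3 <= n <= 6] are checked numerically. *)

Require Import Defs.
From Stdlib Require Import Reals Lra Lia.
Open Scope R_scope.

(* Closes [0 < P] for a polynomial [P] in positive variables which, once expanded,
   has only positive coefficients. *)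
Ltac expanded_positivity :=
  ring_simplify;
  repeat apply Rplus_lt_0_compat;
  repeat apply Rmult_lt_0_compat;
  try apply pow_lt; lra.

(* [n^6] times the lower bound for [V n / V (n - 1)]. *)
Definition ratio_bound (x : R) : R :=
  16 * x ^ 6 + 16 * x ^ 3 + 48 * x ^ 2 + 192 * x + 256.

(** Inductive step for the ratio bound, with [x ^ 6 * s], [a], [d] as three consecutive terms and
    [t] the excess of [a] over its bound. Scaling by [x ^ 6] avoids fractions; the shift [x = m + 2]
    makes every coefficient positive. *)
Lemma ratio_bound_step (m s t d : R) :
  let x := m + 2 in
  let a := ratio_bound x * s + t in
  0 < m -> 0 < s -> 0 < t ->
  x * (x + 1) ^ 2 * d =
    8 * x * (3 * (x + 1) ^ 2 - (x + 1) - 1) * a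
    - 128 * (x - 1) * (x + 1) ^ 2 * (x ^ 6 * s) ->
  ratio_bound (x + 1) * a < (x + 1) ^ 6 * d.
Proof.
intros x a Hm Hs Ht Hd.
assert (Hx : 0 < x * (x + 1) ^ 2).
{ unfold x; apply Rmult_lt_0_compat; [lra | apply pow_lt; lra]. }
apply Rmult_lt_reg_l with (1 := Hx).
replace (x * (x + 1) ^ 2 * ((x + 1) ^ 6 * d))
  with ((x + 1) ^ 6 * (x * (x + 1) ^ 2 * d)) by ring.
rewrite Hd; apply Rlt_0_minus.
unfold a, x, ratio_bound; expanded_positivity.
Qed.

(** With [c, b, a, d, e] for [V (n - 2)], ..., [V (n + 2)] and [x = n], [C], [D], [E] are [c], [d],
    [e] times the coefficients that the recurrence would divide by. The claim is thus the target
    inequality with denominators cleared. *)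
Lemma quartic_form_pos (m s t : R) :
  let x := m + 2 in
  let a := ratio_bound x * s + t in
  let b := x ^ 6 * s in
  let C := 8 * (x - 1) * (3 * x ^ 2 - x - 1) * b - (x - 1) * x ^ 2 * a in
  let D := 8 * x * (3 * (x + 1) ^ 2 - (x + 1) - 1) * a
           - 128 * (x - 1) * (x + 1) ^ 2 * b in
  let E := 8 * (x + 1) * (3 * (x + 2) ^ 2 - (x + 2) - 1) * D
           - 128 * x * (x + 2) ^ 2 * (x * (x + 1) ^ 2 * a) in
  0 < m -> 0 < s -> 0 < t ->
  128 * (x - 2) * x ^ 2 * ((x + 1) * (x + 2) ^ 2)
    * (x * (x + 1) ^ 2 * a ^ 2 - b * D) ^ 2 <
  (128 * (x - 2) * x ^ 2 * b ^ 2 - C * a)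
    * ((x + 1) * (x + 2) ^ 2 * D ^ 2 - x * (x + 1) ^ 2 * a * E).
Proof.
intros x a b C D E Hm Hs Ht; apply Rlt_0_minus.
unfold E, D, C, b, a, x, ratio_bound.
expanded_positivity.
Qed.

Lemma log_convex_of_ratio_bound (x a b c d e : R) :
  2 < x -> 0 < b -> ratio_bound x * b < x ^ 6 * a ->
  (x - 1) * x ^ 2 * a =
    8 * (x - 1) * (3 * x ^ 2 - x - 1) * b - 128 * (x - 2) * x ^ 2 * c ->
  x * (x + 1) ^ 2 * d =
    8 * x * (3 * (x + 1) ^ 2 - (x + 1) - 1) * a
    - 128 * (x - 1) * (x + 1) ^ 2 * b ->
  (x + 1) * (x + 2) ^ 2 * e =
    8 * (x + 1) * (3 * (x + 2) ^ 2 - (x + 2) - 1) * d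
    - 128 * x * (x + 2) ^ 2 * a ->
  (a ^ 2 - b * d) ^ 2 < (b ^ 2 - c * a) * (d ^ 2 - a * e).
Proof.
intros Hx Hb Hab Hc Hd He.
assert (H6 : 0 < x ^ 6) by (apply pow_lt; lra).
assert (Hs : 0 < b / x ^ 6) by (apply Rdiv_lt_0_compat; assumption).
assert (Ht : 0 < a - ratio_bound x * (b / x ^ 6)).
{ apply Rmult_lt_reg_l with (1 := H6); rewrite Rmult_0_r.
  replace (x ^ 6 * (a - ratio_bound x * (b / x ^ 6)))
    with (x ^ 6 * a - ratio_bound x * b) by (field; lra).
  lra. }
pose proof (quartic_form_pos (x - 2) (b / x ^ 6)
  (a - ratio_bound x * (b / x ^ 6)) ltac:(lra) Hs Ht) as Q.
cbv zeta in Q.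
replace (x - 2 + 2) with x in Q by ring.
replace (x ^ 6 * (b / x ^ 6)) with b in Q by (field; lra).
replace (ratio_bound x * (b / x ^ 6) + (a - ratio_bound x * (b / x ^ 6)))
  with a in Q by ring.
rewrite <- Hd in Q.
replace (8 * (x - 1) * (3 * x ^ 2 - x - 1) * b - (x - 1) * x ^ 2 * a)
  with (128 * (x - 2) * x ^ 2 * c) in Q by lra.
replace (8 * (x + 1) * (3 * (x + 2) ^ 2 - (x + 2) - 1) * (x * (x + 1) ^ 2 * d)
         - 128 * x * (x + 2) ^ 2 * (x * (x + 1) ^ 2 * a))
  with (x * (x + 1) ^ 2 * ((x + 1) * (x + 2) ^ 2 * e)) in Q by (rewrite He; ring).
(* The common factor by which both sides of [Q] exceed the goal. *)
assert (HM : 0 < 128 * (x - 2) * x ^ 2 * ((x + 1) * (x + 2) ^ 2)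
                 * (x * (x + 1) ^ 2) ^ 2).
{ repeat apply Rmult_lt_0_compat; try lra; apply pow_lt; lra. }
apply Rmult_lt_reg_l with (1 := HM).
eapply Rle_lt_trans; [| eapply Rlt_le_trans; [exact Q |]];
  apply Req_le; ring.
Qed.

Lemma FLF_recurrence (V : nat -> R) (hV : Fennessey_Larcombe_French V) (n : nat) :
  (INR n + 1) * (INR n + 2) ^ 2 * V (S (S n)) =
    8 * (INR n + 1) * (3 * (INR n + 2) ^ 2 - (INR n + 2) - 1) * V (S n)
    - 128 * INR n * (INR n + 2) ^ 2 * V n.
Proof.
destruct hV as [_ [_ H]].
specialize (H (S (S n)) ltac:(lia)).
replace (S (S n) - 1)%nat with (S n) in H by lia.
replace (S (S n) - 2)%nat with n in H by lia.
rewrite !S_INR in H.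
replace (INR n + 1 + 1 - 1) with (INR n + 1) in H by ring.
replace (INR n + 1 + 1 - 2) with (INR n) in H by ring.
replace (INR n + 1 + 1) with (INR n + 2) in H by ring.
exact H.
Qed.

Lemma FLF_initial_values (V : nat -> R) (hV : Fennessey_Larcombe_French V) :
  V 1%nat = 8 /\ V 2%nat = 144 /\ V 3%nat = 2432 /\ V 4%nat = 40000 /\
  V 5%nat = 649728 /\ V 6%nat = 10486784 /\ V 7%nat = 168681472 /\
  V 8%nat = 2708038656.
Proof.
pose proof hV as [H0 [H1 _]].
pose proof (FLF_recurrence V hV 0) as H2; pose proof (FLF_recurrence V hV 1) as H3.
pose proof (FLF_recurrence V hV 2) as H4; pose proof (FLF_recurrence V hV 3) as H5.
pose proof (FLF_recurrence V hV 4) as H6; pose proof (FLF_recurrence V hV 5) as H7.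
pose proof (FLF_recurrence V hV 6) as H8.
cbn [INR] in *.
repeat split; lra.
Qed.

(** Positivity is carried along: the step needs [0 < V n], and the bound passes it on to
    [V (S n)]. *)
Lemma FLF_ratio_bound (V : nat -> R) (hV : Fennessey_Larcombe_French V) (n : nat) :
  (6 <= n)%nat ->
  0 < V n /\ ratio_bound (INR n + 1) * V n < (INR n + 1) ^ 6 * V (S n).
Proof.
induction 1 as [| n Hn [IHpos IH]].
(* The base is [V 7 / V 6]; the bound still fails for [V 6 / V 5]. *)
- destruct (FLF_initial_values V hV) as [_ [_ [_ [_ [_ [H6 [H7 _]]]]]]].
  rewrite H6, H7; unfold ratio_bound; cbn [INR]; lra.
- apply le_INR in Hn; cbn [INR] in Hn.
  assert (Hx : 0 < (INR n + 1) ^ 6) by (apply pow_lt; lra).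
  assert (Hs : 0 < V n / (INR n + 1) ^ 6) by (apply Rdiv_lt_0_compat; assumption).
  assert (Ht : 0 < V (S n) - ratio_bound (INR n + 1) * (V n / (INR n + 1) ^ 6)).
  { apply Rmult_lt_reg_l with (1 := Hx); rewrite Rmult_0_r.
    replace ((INR n + 1) ^ 6 *
             (V (S n) - ratio_bound (INR n + 1) * (V n / (INR n + 1) ^ 6)))
      with ((INR n + 1) ^ 6 * V (S n) - ratio_bound (INR n + 1) * V n)
      by (field; lra).
    lra. }
  assert (Hb : 0 < ratio_bound (INR n + 1)) by (unfold ratio_bound; nra).
  split.
  + apply Rmult_lt_reg_l with (1 := Hx); rewrite Rmult_0_r.
    apply Rlt_trans with (2 := IH); apply Rmult_lt_0_compat; assumption.
  + pose proof (ratio_bound_step (INR n - 1) _ _ (V (S (S n)))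
      ltac:(lra) Hs Ht) as Q.
    cbv zeta in Q; rewrite S_INR.
    replace (INR n - 1 + 2) with (INR n + 1) in Q by ring.
    replace ((INR n + 1) ^ 6 * (V n / (INR n + 1) ^ 6)) with (V n) in Q
      by (field; lra).
    replace (ratio_bound (INR n + 1) * (V n / (INR n + 1) ^ 6)
       + (V (S n) - ratio_bound (INR n + 1) * (V n / (INR n + 1) ^ 6)))
      with (V (S n)) in Q by ring.
    apply Q.
    replace (INR n + 1 + 1) with (INR n + 2) by ring.
    rewrite (FLF_recurrence V hV); ring.
Qed.

Theorem theorem1p1 (V : nat -> R) (hV : Fennessey_Larcombe_French V) :
  strictly_log_convex_from 2
    (fun n : nat => V n ^ 2 - V (n - 1)%nat * V (n + 1)%nat).
Proof.
intros n Hn; cbv beta.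
destruct (Nat.le_gt_cases 7 n) as [H7 | H7].
- destruct n as [| [| k]]; [lia | lia |].
  replace (S (S k) - 1)%nat with (S k) by lia.
  replace (S (S k) + 1)%nat with (S (S (S k))) by lia.
  replace (S k - 1)%nat with k by lia.
  replace (S k + 1)%nat with (S (S k)) by lia.
  replace (S (S (S k)) - 1)%nat with (S (S k)) by lia.
  replace (S (S (S k)) + 1)%nat with (S (S (S (S k)))) by lia.
  destruct (FLF_ratio_bound V hV (S k) ltac:(lia)) as [Hb Hab].
  pose proof (FLF_recurrence V hV k) as R0.
  pose proof (FLF_recurrence V hV (S k)) as R1.
  pose proof (FLF_recurrence V hV (S (S k))) as R2.
  assert (Hk : 0 < INR k) by (apply lt_0_INR; lia).
  rewrite !S_INR in *.
  replace (INR k + 1 + 1) with (INR k + 2) in * by ring.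
  apply log_convex_of_ratio_bound with (x := INR k + 2); try assumption.
  + lra.
  + replace (INR k + 2 - 1) with (INR k + 1) by ring.
    replace (INR k + 2 - 2) with (INR k) by ring.
    exact R0.
  + replace (INR k + 2 + 1) with (INR k + 1 + 2) by ring.
    replace (INR k + 2 - 1) with (INR k + 1) by ring.
    exact R1.
- destruct (FLF_initial_values V hV) as
    [V1 [V2 [V3 [V4 [V5 [V6 [V7 V8]]]]]]].
  (* These cases involve only [V 1] to [V 8]. *)
  assert (Hcase : n = 3%nat \/ n = 4%nat \/ n = 5%nat \/ n = 6%nat) by lia.
  destruct Hcase as [-> | [-> | [-> | ->]]]; cbn [Nat.sub Nat.add];
    rewrite ?V1, ?V2, ?V3, ?V4, ?V5, ?V6, ?V7, ?V8; lra.
Qed.
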